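(* Let $B=(V,E)$ be a generalized Bratteli diagram with Markov matrices $(P_n)$, positive vectors $q^{(n)}$ and stochastic matrices $\widehat P_n=(\widehat p_n(v,u))$ as in the context. Suppose that a function $f=(f_n)$ on $V$ is such that every $f_n$ belongs to $\mathcal H_n$, $n\ge 0$. Then $f\in\mathcal H_E$ if and only if $$\sum_{n\ge0}\Big(\|f_n\|^2_{\mathcal H_n}-2\langle f_n,T_{\widehat P_n}(f_{n+1})\rangle_{\mathcal H_n}+\|f_{n+1}\|^2_{\mathcal H_{n+1}}\Big)<\infty .$$
   Context: A generalized Bratteli diagram $B=(V,E)$ is a graded graph with $V=\bigsqcup_{n\ge0}V_n$, each $V_n$ being a copy of a fixed countably infinite set $V_0$, and $E=\bigsqcup_{n\ge 0}E_n$, where $E_n$ is the set of edges between $V_n$ and $V_{n+1}$. Each $e\in E_n$ has a source $s(e)\in V_n$ and a range $r(e)\in V_{n+1}$. For $w\in V_n$, $v\in V_{n+1}$ the set $E(w,v)$ of edges with source $w$ and range $v$ is finite (possibly empty). The incidence matrix $F_n=(|E(w,v)|: v\in V_{n+1}, w\in V_n)$ has only finitely many non-zero entries in each row and has no zero row and no zero column. Let $P_n=(p^{(n)}_{v,e}: v\in V_n, e\in E_n)$, $n\ge0$, be Markov matrices: $p^{(n)}_{v,e}\ge 0$, $p^{(n)}_{v,e}>0\iff s(e)=v$, $\sum_{e:\,s(e)=v}p^{(n)}_{v,e}=1$. Let $q^{(0)}$ be a positive vector on $V_0$. Put $\widehat p_n(v,u)=\sum_{e\in E(v,u)}p^{(n)}_{v,e}$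 and $q^{(n+1)}_u=\sum_{v\in V_n}q^{(n)}_v\widehat p_n(v,u)$ for $v\in V_n,u\in V_{n+1}$. $\mathcal H_n$ is the real Hilbert space of functions on $V_n$ with $\|g\|^2_{\mathcal H_n}=\sum_{v\in V_n}q^{(n)}_vg(v)^2<\infty$ and inner product $\langle\varphi,\psi\rangle_{\mathcal H_n}=\sum_{v\in V_n}\varphi(v)\psi(v)q^{(n)}_v$. The operator $T_{\widehat P_n}:\mathcal H_{n+1}\to\mathcal H_n$ is $(T_{\widehat P_n}g)(v)=\sum_{u\in V_{n+1}}\widehat p_n(v,u)g(u)$. The finite energy space $\mathcal H_E$ consists of (classes modulo constants of) functions $f=(f_n)$ on $V$, $f_n:V_n\to\mathbb R$, with $$\|f\|^2_{\mathcal H_E}=\frac12\sum_{n\ge0}\ \sum_{v\in V_n,\,u\in V_{n+1}}q^{(n)}_v\widehat p_n(v,u)\big(f_n(v)-f_{n+1}(u)\big)^2<\infty .$$ *)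

(* Defs.v *)
From HB Require Import structures.
From mathcomp Require Import all_boot all_order all_algebra.
From mathcomp Require Import finmap.
From mathcomp Require Import all_classical all_reals all_analysis.

Set Implicit Arguments.
Unset Strict Implicit.
Unset Printing Implicit Defensive.

Import Order.TTheory GRing.Theory Num.Theory.
Import numFieldNormedType.Exports.

Local Open Scope classical_set_scope.
Local Open Scope ring_scope.

(* The level V_n is represented by the type V0 itself, for every n: a vertex
   of the diagram is a pair (n, v), and a function f on the set of all
   vertices is a family f : nat -> V0 -> R with f n standing for f_n. *)
Record graded_graph (V0 : choiceType) := GradedGraph {
  edge : nat -> choiceType ;
  esource : forall n, edge n -> V0 ;  (* vertex of level n *)
  erange : forall n, edge n -> V0     (* vertex of level n.+1 *)
}.
Arguments esource {V0} g {n} e.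
Arguments erange {V0} g {n} e.

Section bratteli.
Context {V0 : choiceType}.

Definition edges (B : graded_graph V0) (n : nat) (w v : V0) : set (edge B n) :=
  [set e | esource B e = w /\ erange B e = v].
Arguments edges : clear implicits.

(* Rows are indexed by level n.+1 and columns by level n. The cardinal #|` _ |
   is the right one only when the set of edges is finite. *)
Definition incidence (B : graded_graph V0) (n : nat) (v w : V0) : nat :=
  #|` fset_set (edges B n w v)|.
Arguments incidence : clear implicits.

Record generalized_bratteli (B : graded_graph V0) : Prop := {
  vertices_countable : countable [set: V0] ;
  vertices_infinite : infinite_set [set: V0] ;
  edges_finite : forall n w v, finite_set (edges B n w v) ;
  row_finite : forall n v, finite_set [set w | incidence B n v w != 0%N] ;
  row_nonzero : forall n v, exists w, incidence B n v w != 0%N ;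
  column_nonzero : forall n w, exists v, incidence B n v w != 0%N
}.

Context {R : realType}.

(* A vertex may have infinitely many outgoing edges, hence \esum. *)
Record markov_matrices (B : graded_graph V0)
    (p : forall n, V0 -> edge B n -> R) : Prop := {
  markov_ge0 : forall n v (e : edge B n), 0 <= p n v e ;
  markov_gt0 : forall n v (e : edge B n), 0 < p n v e <-> esource B e = v ;
  markov_sum1 : forall n v,
    (\esum_(e in [set e : edge B n | esource B e = v]) (p n v e)%:E = 1)%E
}.

Definition phat (B : graded_graph V0) (p : forall n, V0 -> edge B n -> R)
    (n : nat) (v u : V0) : R :=
  \sum_(e \in edges B n v u) p n v e.

(* The sum over v has finite support, because the rows of the incidence
   matrices do. *)
Fixpoint qvec (B : graded_graph V0) (p : forall n, V0 -> edge B n -> R)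
    (q0 : V0 -> R) (n : nat) : V0 -> R :=
  if n is m.+1 then
    fun u => \sum_(v \in [set: V0]) qvec p q0 m v * phat p m v u
  else q0.

(* Sum of an absolutely summable real family of arbitrary sign: \esum alone is
   only meaningful for nonnegative families. *)
Definition rsum (I : choiceType) (a : I -> R) : R :=
  fine (\esum_(i in [set: I]) (a^\+ i)%:E)
  - fine (\esum_(i in [set: I]) (a^\- i)%:E).

(* The space H_n, its squared norm and its inner product, for the weight
   q = q^(n). *)
Definition Hnorm2 (q : V0 -> R) (g : V0 -> R) : \bar R :=
  \esum_(v in [set: V0]) (q v * g v ^+ 2)%:E.

Definition Hspace (q : V0 -> R) : set (V0 -> R) :=
  [set g | (Hnorm2 q g < +oo)%E].

Definition Hinner (q : V0 -> R) (phi psi : V0 -> R) : R :=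
  rsum (fun v => phi v * psi v * q v).

Definition Top (B : graded_graph V0) (p : forall n, V0 -> edge B n -> R)
    (n : nat) (g : V0 -> R) : V0 -> R :=
  fun v => rsum (fun u => phat p n v u * g u).

Definition energy (B : graded_graph V0) (p : forall n, V0 -> edge B n -> R)
    (q0 : V0 -> R) (f : nat -> V0 -> R) : \bar R :=
  ((2^-1)%:E * \sum_(0 <= n <oo) \esum_(vu in [set: V0 * V0])
     (qvec p q0 n vu.1 * phat p n vu.1 vu.2
      * (f n vu.1 - f n.+1 vu.2) ^+ 2)%:E)%E.

Definition class_mod_constants (f : nat -> V0 -> R) : set (nat -> V0 -> R) :=
  [set g | exists c : R, forall n v, g n v = f n v + c].

Definition finite_energy_space (B : graded_graph V0)
    (p : forall n, V0 -> edge B n -> R) (q0 : V0 -> R) :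
    set (set (nat -> V0 -> R)) :=
  [set class_mod_constants f | f in [set f | (energy p q0 f < +oo)%E]].

End bratteli.

(* Main.v *)
Require Import Defs.
From HB Require Import structures.
From mathcomp Require Import all_boot all_order all_algebra.
From mathcomp Require Import finmap.
From mathcomp Require Import all_classical all_reals all_analysis.
From mathcomp Require Import ring.

Import Order.TTheory GRing.Theory Num.Theory.
Import numFieldNormedType.Exports.

Local Open Scope classical_set_scope.
Local Open Scope ring_scope.

(** The n-th summand of the series equals the level-n sum in the energy ([esum_dirichlet]). On
    expanding [(f_n(v) - f_{n+1}(u))^2] against the weights [q_v * phat v u], the part in [f_n^2]
    collapses to the norm of [f_n] because the rows of [phat] sum to 1 ([phat_sum1]). The part in
    [f_{n+1}^2] collapses to the next norm by the recursion for [q] ([qvecS]), and the cross part is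
    the inner product with the operator. The summands are therefore nonnegative, so convergence of
    the series is finiteness of the energy ([energy_lty]), which depends only on the class modulo
    constants ([finite_energy_spaceE]). The delicate point is the signed cross part, an iterated
    [rsum]. *)

Lemma ge0_esumZl (R : realType) (T : choiceType) (I : set T) (c : R)
    (a : T -> \bar R) :
  0 <= c -> (forall i, (0 <= a i)%E) ->
  (\esum_(i in I) (c%:E * a i) = c%:E * \esum_(i in I) a i)%E.
Proof.
have le_esumZ (d : R) (b : T -> \bar R) : 0 <= d -> (forall i, (0 <= b i)%E) ->
    (\esum_(i in I) (d%:E * b i) <= d%:E * \esum_(i in I) b i)%E.
  move=> d0 b0; apply: ge_ereal_sup => _ /= [X [finX XI] <-].
  by rewrite -ge0_mule_fsumr// lee_wpmul2l ?lee_fin//; apply: esum_ge; exists X.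
rewrite le_eqVlt => /predU1P[<-|c0] a0.
  by rewrite mul0e esum1// => i _; rewrite mul0e.
(* The reverse inequality is [le_esumZ] for the constant [c^-1]. *)
apply/eqP; rewrite eq_le le_esumZ ?(ltW c0)//= -lee_pdivlMl//.
apply: le_trans (le_esumZ _ _ _ _); rewrite ?invr_ge0 ?(ltW c0)//.
  apply: le_esum => i _; rewrite muleA -EFinM mulVf ?gt_eqF// mul1e//.
by move=> i; rewrite mule_ge0// lee_fin ltW.
Qed.

(** Any splitting into nonnegative summable families computes [rsum], not only the canonical one:
    the positive and negative parts of [x - y] are dominated by [x] and [y]. *)
Lemma rsumB (R : realType) (I : choiceType) (x y : I -> R) :
  (forall i, 0 <= x i) -> (forall i, 0 <= y i) ->
  (\esum_(i in [set: I]) (x i)%:E < +oo)%E ->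
  (\esum_(i in [set: I]) (y i)%:E < +oo)%E ->
  rsum (fun i => x i - y i) =
  fine (\esum_(i in [set: I]) (x i)%:E) - fine (\esum_(i in [set: I]) (y i)%:E).
Proof.
move=> x0 y0 xoo yoo; rewrite /rsum.
set p := (\esum_(i in _) ((_)^\+ i)%:E)%E.
set n := (\esum_(i in _) ((_)^\- i)%:E)%E.
have pfin : p \is a fin_num.
  rewrite ge0_fin_numE; last by apply: esum_ge0 => i _; rewrite lee_fin.
  apply: le_lt_trans xoo; apply: le_esum => i _.
  by rewrite lee_fin ge_max x0 andbT lerBlDr lerDl.
have nfin : n \is a fin_num.
  rewrite ge0_fin_numE; last by apply: esum_ge0 => i _; rewrite lee_fin.
  apply: le_lt_trans yoo; apply: le_esum => i _.
  by rewrite lee_fin ge_max y0 andbT opprB lerBlDr lerDl.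
have sx : summable [set: I] (EFin \o x).
  by rewrite /summable; under eq_esum do rewrite /= ger0_norm//.
have sy : summable [set: I] (EFin \o y).
  by rewrite /summable; under eq_esum do rewrite /= ger0_norm//.
have xfin : (\esum_(i in [set: I]) (x i)%:E)%E \is a fin_num.
  by rewrite ge0_fin_numE// esum_ge0// => i _; rewrite lee_fin.
have yfin : (\esum_(i in [set: I]) (y i)%:E)%E \is a fin_num.
  by rewrite ge0_fin_numE// esum_ge0// => i _; rewrite lee_fin.
have := esumB sx sy (fun i _ => x0 i) (fun i _ => y0 i).
rewrite -!fineB//= => <-; congr (fine (_ - _))%E; apply: eq_esum => i _.
  by rewrite funeposE /= -EFin_max.
by rewrite funenegE /= -EFin_max.
Qed.

Lemma rsumZ (R : realType) (I : choiceType) (c : R) (a : I -> R) :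
  rsum (fun i => c * a i) = c * rsum a.
Proof.
(* Negation exchanges the positive and negative parts, which reduces to [0 <= c]. *)
wlog c0 : c a / 0 <= c => [hwlog|].
  have [/hwlog//|/ltW c0] := leP 0 c.
  have rsumN b : rsum (fun i : I => - b i) = - rsum b.
    by rewrite /rsum opprB (funrposN b) (funrnegN b).
  rewrite -[c]opprK mulNr -hwlog ?oppr_ge0// -rsumN.
  by congr rsum; apply/funext => i; rewrite mulNr.
rewrite /rsum mulrBr.
have fZ (b : I -> R) : (forall i, 0 <= b i) ->
    fine (\esum_(i in [set: I]) (c * b i)%:E) =
    c * fine (\esum_(i in [set: I]) (b i)%:E).
  move=> b0; under eq_esum do rewrite EFinM.
  rewrite ge0_esumZl//.
  have : (0 <= \esum_(i in [set: I]) (b i)%:E)%E.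
    by apply: esum_ge0 => i _; rewrite lee_fin.
  (* A divergent sum is harmless: [fine] sends [+oo] to 0, on both sides. *)
  case: esum => [r _|_|]//=.
  have [->|cN0] := eqVneq c 0; first by rewrite mul0e mul0r.
  by rewrite gt0_muley /= ?mulr0// lte_fin lt_neqAle eq_sym cN0.
rewrite -!fZ => [|i|i]; [|exact: funrneg_ge0|exact: funrpos_ge0].
by rewrite (ge0_funrposM a c0) (ge0_funrnegM a c0).
Qed.

(** * Double sums and the energy of one level *)

Lemma esum_pair (R : realType) (V W : choiceType) (a : V -> W -> R) :
  (forall v w, 0 <= a v w) ->
  (\esum_(vw in [set: V * W]) (a vw.1 vw.2)%:E =
   \esum_(v in [set: V]) \esum_(w in [set: W]) (a v w)%:E)%E.
Proof.
move=> a0; rewrite esum_esum; last by move=> *; rewrite lee_fin.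
by congr esum; apply/seteqP; split.
Qed.

Lemma esum_pairC (R : realType) (V W : choiceType) (a : V -> W -> R) :
  (forall v w, 0 <= a v w) ->
  (\esum_(vw in [set: V * W]) (a vw.1 vw.2)%:E =
   \esum_(w in [set: W]) \esum_(v in [set: V]) (a v w)%:E)%E.
Proof.
move=> a0; rewrite -(@esum_pair _ W V (fun w v => a v w))//.
apply: (@reindex_esum _ _ _ _ _ (fun wv : W * V => (wv.2, wv.1))
  (fun vw => (a vw.1 vw.2)%:E)).
split=> //; first by move=> [? ?] [? ?] _ _ /= [-> ->].
by move=> [v w] _; exists (w, v).
Qed.

(* The polarization [2 a f g = a (f^2 + g^2) - a (f - g)^2] writes the cross
   term as a difference of two nonnegative summable families, to which
   Tonelli's theorem applies. *)
Lemma esum_dirichlet (R : realType) (V W : choiceType) (q : V -> R) (r : W -> R)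
    (P : V -> W -> R) (f : V -> R) (g : W -> R) :
  (forall v, 0 <= q v) -> (forall v w, 0 <= P v w) ->
  (forall v, \esum_(w in [set: W]) (P v w)%:E = 1)%E ->
  (forall w, (r w)%:E = \esum_(v in [set: V]) (q v * P v w)%:E)%E ->
  (Hnorm2 q f < +oo)%E -> (Hnorm2 r g < +oo)%E ->
  (\esum_(vw in [set: V * W])
     (q vw.1 * P vw.1 vw.2 * (f vw.1 - g vw.2) ^+ 2)%:E)%E =
  (fine (Hnorm2 q f)
   - 2 * Hinner q f (fun v => rsum (fun w => P v w * g w))
   + fine (Hnorm2 r g))%:E.
Proof.
move=> q0 P0 P1 rE foo goo.
pose af v w := q v * P v w * f v ^+ 2.
pose ag v w := q v * P v w * g w ^+ 2.
pose x v w := af v w + ag v w.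
pose y v w := q v * P v w * (f v - g w) ^+ 2.
have af0 v w : 0 <= af v w by rewrite mulr_ge0 ?sqr_ge0// mulr_ge0.
have ag0 v w : 0 <= ag v w by rewrite mulr_ge0 ?sqr_ge0// mulr_ge0.
have x0 v w : 0 <= x v w by rewrite addr_ge0.
have y0 v w : 0 <= y v w by rewrite mulr_ge0 ?sqr_ge0// mulr_ge0.
have afE : (\esum_(vw in [set: V * W]) (af vw.1 vw.2)%:E = Hnorm2 q f)%E.
  rewrite esum_pair//; apply: eq_esum => v _.
  under eq_esum => w _.
    rewrite (_ : (af v w)%:E = ((q v * f v ^+ 2)%:E * (P v w)%:E)%E); last first.
      by rewrite /af -EFinM; congr EFin; ring.
    over.
  by rewrite ge0_esumZl ?P1 ?mule1 ?(mulr_ge0 _ (sqr_ge0 _))// => w; rewrite lee_fin.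
have agE : (\esum_(vw in [set: V * W]) (ag vw.1 vw.2)%:E = Hnorm2 r g)%E.
  rewrite esum_pairC//; apply: eq_esum => w _.
  under eq_esum => v _.
    rewrite (_ : (ag v w)%:E = ((g w ^+ 2)%:E * (q v * P v w)%:E)%E); last first.
      by rewrite /ag -EFinM; congr EFin; ring.
    over.
  rewrite ge0_esumZl ?sqr_ge0//; last by move=> v; rewrite lee_fin mulr_ge0.
  by rewrite -rE -EFinM mulrC.
have xE : (\esum_(vw in [set: V * W]) (x vw.1 vw.2)%:E
    = Hnorm2 q f + Hnorm2 r g)%E.
  by rewrite -afE -agE -esumD// => vw _; rewrite lee_fin.
have xoo : (\esum_(vw in [set: V * W]) (x vw.1 vw.2)%:E < +oo)%E.
  by rewrite xE lte_add_pinfty.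
(* [(f - g)^2 <= 2 (f^2 + g^2)], the gap being [(f + g)^2]. *)
have yoo : (\esum_(vw in [set: V * W]) (y vw.1 vw.2)%:E < +oo)%E.
  apply: (@le_lt_trans _ _
      (2%:E * \esum_(vw in [set: V * W]) (x vw.1 vw.2)%:E)%E).
    rewrite -ge0_esumZl//; last by move=> vw; rewrite lee_fin.
    apply: le_esum => vw _; rewrite -EFinM lee_fin -subr_ge0.
    rewrite (_ : _ - _ = q vw.1 * P vw.1 vw.2 * (f vw.1 + g vw.2) ^+ 2).
      by rewrite mulr_ge0 ?sqr_ge0// mulr_ge0.
    by rewrite /x /y /af /ag; ring.
  by rewrite lte_mul_pinfty// ?lee_fin.
have X0 v : (0 <= \esum_(w in [set: W]) (x v w)%:E)%E.
  by apply: esum_ge0 => w _; rewrite lee_fin.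
have Y0 v : (0 <= \esum_(w in [set: W]) (y v w)%:E)%E.
  by apply: esum_ge0 => w _; rewrite lee_fin.
have rowoo (z : V -> W -> R) : (forall v w, 0 <= z v w) ->
    (\esum_(vw in [set: V * W]) (z vw.1 vw.2)%:E < +oo)%E ->
    forall v, (\esum_(w in [set: W]) (z v w)%:E < +oo)%E.
  move=> z0 zoo v; apply: le_lt_trans zoo; rewrite esum_pair//.
  (* A single row is a one-term partial sum of the iterated sum. *)
  apply: esum_ge; exists [set v]; first by split=> //; exact: finite_set1.
  by rewrite fsbig_set1.
have xrow := rowoo _ x0 xoo; have yrow := rowoo _ y0 yoo.
have totalE (z : V -> W -> R) : (forall v w, 0 <= z v w) ->
    (\esum_(vw in [set: V * W]) (z vw.1 vw.2)%:E < +oo)%E ->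
    (\esum_(v in [set: V]) (fine (\esum_(w in [set: W]) (z v w)%:E))%:E =
     \esum_(vw in [set: V * W]) (z vw.1 vw.2)%:E)%E.
  move=> z0 zoo; rewrite esum_pair//; apply: eq_esum => v _.
  rewrite fineK// ge0_fin_numE; first exact: rowoo.
  by apply: esum_ge0 => w _; rewrite lee_fin.
(* [rsumB] is used twice: on the row sums of [x] and [y] as families in [v], then inside each row,
   where [2 f(v) q(v) P(v,w) g(w)] is [x v w - y v w]. *)
have innerE : 2 * Hinner q f (fun v => rsum (fun w => P v w * g w)) =
    fine (\esum_(vw in [set: V * W]) (x vw.1 vw.2)%:E)
    - fine (\esum_(vw in [set: V * W]) (y vw.1 vw.2)%:E).
  rewrite /Hinner -rsumZ -(totalE x)// -(totalE y)// -rsumB ?totalE//.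
  - congr rsum; apply/funext => v; rewrite -rsumB//.
    rewrite (_ : 2 * _ = 2 * f v * q v * rsum (fun w => P v w * g w)); last ring.
    rewrite -rsumZ; congr rsum; apply/funext => w.
    by rewrite /x /y /af /ag; ring.
  - by move=> v; exact: fine_ge0.
  - by move=> v; exact: fine_ge0.
have ffin : Hnorm2 q f \is a fin_num.
  by rewrite ge0_fin_numE// -afE esum_ge0// => vw _; rewrite lee_fin.
have gfin : Hnorm2 r g \is a fin_num.
  by rewrite ge0_fin_numE// -agE esum_ge0// => vw _; rewrite lee_fin.
rewrite innerE xE fineD// -[LHS]fineK; last first.
  by rewrite ge0_fin_numE// esum_ge0// => vw _; rewrite lee_fin y0.
by congr EFin; rewrite -/(y _ _); ring.
Qed.

(** * Stochasticity of [phat] and the recursion for [q] *)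

Section diagram.
Context {R : realType} {V0 : choiceType} {B : graded_graph V0}.
Hypothesis hB : generalized_bratteli B.
Variables (p : forall n, V0 -> edge B n -> R) (q0 : V0 -> R).
Hypothesis hp : markov_matrices p.
Hypothesis hq0 : forall v, 0 <= q0 v.

Lemma phat_ge0 n v u : 0 <= phat p n v u.
Proof. by apply: fsumr_ge0 => e _; exact: (markov_ge0 hp). Qed.

Lemma phat_eq0 n v u : incidence B n u v = 0%N -> phat p n v u = 0.
Proof.
move=> /eqP; rewrite cardfs_eq0 => /eqP.
move=> /(congr1 (fun A : {fset _} => [set` A])).
(* Finiteness matters: [fset_set] of an infinite set is empty too. *)
rewrite fset_setK ?set_fset0; last exact: (edges_finite hB).
by rewrite /phat => ->; rewrite fsbig_set0.
Qed.

(** The edges leaving [v] are partitioned by their range into finite sets, so this is the Markov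
    condition summed by blocks. *)
Lemma phat_sum1 n v : (\esum_(u in [set: V0]) (phat p n v u)%:E = 1)%E.
Proof.
have p0 e : (0 <= (p n v e)%:E)%E by rewrite lee_fin (markov_ge0 hp).
rewrite -(markov_sum1 hp n v).
rewrite (@reindex_esum _ _ _ ([set: V0] `*`` @edges _ B n v) _ snd).
  rewrite -(@esum_esum _ _ _ _ _ (fun _ e => (p n v e)%:E))//; apply: eq_esum => u _.
  have fin := edges_finite hB n v u.
  by rewrite esum_fset ?fsumEFin.
split.
- by move=> [u e] [_ []].
- move=> [u e] [w e']; rewrite !inE => -[_ [_ /= <-]] [_ [_ /= <-]] /= ->.
  by [].
- by move=> e /= ev; exists (erange B e, e).
Qed.

Lemma qvec_ge0 n v : 0 <= qvec p q0 n v.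
Proof.
elim: n v => [|n IHn] v /=; first exact: hq0.
by apply: fsumr_ge0 => w _; rewrite mulr_ge0 ?phat_ge0.
Qed.

(** The finitary sum defining [qvec] would be 0 on an infinite support; row finiteness of the
    incidence matrix confines the support to a finite set, where both sums agree. *)
Lemma qvecS n u : ((qvec p q0 n.+1 u)%:E =
  \esum_(v in [set: V0]) (qvec p q0 n v * phat p n v u)%:E)%E.
Proof.
have fin := row_finite hB n u.
have out v : ~ [set w | incidence B n u w != 0%N] v ->
    qvec p q0 n v * phat p n v u = 0.
  by move=> /negP/negPn/eqP /phat_eq0 ->; rewrite mulr0.
rewrite /= -(@fsbig_widen _ _ _ _ [set w | incidence B n u w != 0%N])//=; last first.
  by move=> v [_ /out].
rewrite -fsumEFin// -esum_fset//; last first.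
  by move=> v _; rewrite lee_fin mulr_ge0 ?qvec_ge0 ?phat_ge0.
rewrite esum_mkcond; apply: eq_esum => v _.
by case: ifPn => // /negP; rewrite inE => /out ->.
Qed.

End diagram.

Lemma energy_lty (R : realType) (V0 : choiceType) (B : graded_graph V0)
    (p : forall n, V0 -> edge B n -> R) (q0 : V0 -> R) (f : nat -> V0 -> R)
    (d : nat -> R) :
  (forall n, 0 <= d n) ->
  (forall n, \esum_(vu in [set: V0 * V0])
     (qvec p q0 n vu.1 * phat p n vu.1 vu.2
      * (f n vu.1 - f n.+1 vu.2) ^+ 2)%:E = (d n)%:E)%E ->
  (energy p q0 f < +oo)%E <-> cvgn (series d).
Proof.
move=> d0 dE; rewrite /energy.
under eq_eseriesr do rewrite dE.
split => [Eoo|dcvg].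
  apply: nnseries_is_cvg => //.
  (* An infinite sum stays infinite after multiplication by [2^-1]. *)
  rewrite ltey; apply/eqP => doo; move: Eoo.
  by rewrite doo gt0_muley// lte_fin invr_gt0.
rewrite lte_mul_pinfty ?lee_fin ?invr_ge0//.
rewrite (_ : (fun n => _) = EFin \o series d); first by rewrite EFin_lim// ltry.
by apply/funext => n /=; rewrite sumEFin.
Qed.

(** Two representatives of a class have the same energy, since the constant cancels in each
    difference. *)
Lemma finite_energy_spaceE (R : realType) (V0 : choiceType) (B : graded_graph V0)
    (p : forall n, V0 -> edge B n -> R) (q0 : V0 -> R) (f : nat -> V0 -> R) :
  finite_energy_space p q0 (class_mod_constants f) <-> (energy p q0 f < +oo)%E.
Proof.
split=> [[g /= goo gf]|foo]; last by exists f.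
have : class_mod_constants f f by exists 0 => n v; rewrite addr0.
rewrite -gf => -[c fE]; apply: le_lt_trans goo.
rewrite /energy le_eqVlt; apply/orP; left; apply/eqP; congr (_ * _)%E.
apply: eq_eseriesr => n _; apply: eq_esum => vu _; rewrite !fE.
by congr (_ * _ ^+ 2)%:E; ring.
Qed.

Theorem proposition4p8 (R : realType) (V0 : choiceType) (B : graded_graph V0)
    (hB : generalized_bratteli B)
    (p : forall n, V0 -> edge B n -> R) (hp : markov_matrices p)
    (q0 : V0 -> R) (hq0 : forall v, 0 < q0 v)
    (f : nat -> V0 -> R) (hf : forall n, Hspace (qvec p q0 n) (f n)) :
  finite_energy_space p q0 (class_mod_constants f) <->
  cvgn (series (fun n =>
    fine (Hnorm2 (qvec p q0 n) (f n))
    - 2 * Hinner (qvec p q0 n) (f n) (Top p n (f n.+1))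
    + fine (Hnorm2 (qvec p q0 n.+1) (f n.+1)))).
Proof.
have q0_ge0 v : 0 <= q0 v by exact: ltW.
rewrite finite_energy_spaceE.
have q_ge0 := qvec_ge0 p q0 hp q0_ge0; have P_ge0 := phat_ge0 p hp.
have dE n := esum_dirichlet _ _ _ _ _ _ _ _ (q_ge0 n) (P_ge0 n)
  (phat_sum1 hB p hp n) (qvecS hB p q0 hp q0_ge0 n) (hf n) (hf n.+1).
(* The summand is nonnegative because it is a sum of weighted squares. *)
apply: energy_lty => // n; rewrite -lee_fin -dE.
apply: esum_ge0 => vu _.
by rewrite lee_fin mulr_ge0 ?sqr_ge0// mulr_ge0.
Qed.
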